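(* Let $H_1,H_2,V_1,V_2$ be complex Hilbert spaces with $V_k$ densely (and continuously) embedded in $H_k$ for $k\in\{1,2\}$. For $k\in\{1,2\}$ let $a_k\colon V_k\times V_k\to\mathbb{C}$ be a continuous elliptic sesquilinear form, let $A_k$ be the operator in $H_k$ associated with $a_k$, and let $S^k=(S^k_t)_{t>0}$ be the semigroup on $H_k$ generated by $-A_k$. Let $\Phi\in\mathcal{L}(H_1,H_2)$ be unitary. Then the following are equivalent. (i) $S^2_t\,\Phi=\Phi\,S^1_t$ for all $t>0$. (ii) $\Phi(V_1)=V_2$ and $a_2(\Phi u,\Phi v)=a_1(u,v)$ for all $u,v\in V_1$.
   Context: A continuous sesquilinear form $a\colon V\times V\to\mathbb{C}$, where $V$ is densely embedded in the Hilbert space $H$, is called elliptic if there exist $\omega\in\mathbb{R}$ and $\mu>0$ such that $\operatorname{Re}a(u,u)+\omega\|u\|_H^2\ge\mu\|u\|_V^2$ for all $u\in V$. The operator $A$ in $H$ associated with $a$ has domain $D(A)=\{u\in V:\text{there is an } f\in H \text{ with } a(u,v)=(f,v)_H\text{ for all }v\in V\}$, and $Au=f$ for such $u,f$. Then $-A$ generates a holomorphic $C_0$-semigroup on $H$. No self-adjointness is assumed. $\mathcal{L}(H_1,H_2)$ denotes the bounded linear operators from $H_1$ to $H_2$. *)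

(* Defs.v *)
From HB Require Import structures.
From mathcomp Require Import all_boot all_order all_algebra.
From mathcomp Require Import complex.
From mathcomp Require Import all_classical all_reals all_analysis.

Set Implicit Arguments.
Unset Strict Implicit.
Unset Printing Implicit Defensive.

Import Order.TTheory GRing.Theory Num.Theory.
Import numFieldNormedType.Exports.

Local Open Scope classical_set_scope.
Local Open Scope ring_scope.
Local Open Scope complex_scope.

(* The inner product is linear in its first argument and conjugate-linear in
   its second one. *)
HB.mixin Record isHilbert (R : realType) (H : Type)
    of CompleteNormedModule R[i] H := {
  inner : {dot H for (@Num.conj R[i])} ;
  normr_inner : forall x : H, `|x| ^+ 2 = inner x x }.

#[short(type="hilbertType")]
HB.structure Definition Hilbert (R : realType) :=
  { H of isHilbert R H & CompleteNormedModule R[i] H }.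

Section Forms.
Context {R : realType}.

Definition sesquilinear_form (V : hilbertType R) :=
  {bilinear V -> V -> R[i] | *%R & (@Num.conj R[i]) \; *%R}.

(* [R[i]^o] is [R[i]] with the topology given by the modulus. *)
Definition continuous_form (V : hilbertType R) (a : sesquilinear_form V) : Prop :=
  continuous (fun p : V * V => a p.1 p.2 : R[i]^o).

(* The inclusion of V into H is a map [j]; V carries its own Hilbert space
   structure, and the elements of V, seen in H, are [range j]. *)
Definition dense_embedding (V H : hilbertType R) (j : {linear V -> H}) : Prop :=
  [/\ injective j, continuous j & dense (range j)].

Definition elliptic (V H : hilbertType R) (j : {linear V -> H})
    (a : sesquilinear_form V) : Prop :=
  exists omega mu : R, 0 < mu /\
    forall u : V,
      mu%:C * `|u| ^+ 2 <= 'Re (a u u) + omega%:C * `|j u| ^+ 2.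

(* Operators in H are given by their graphs. As [range j] is dense, f is
   determined by x below. *)
Definition associated_operator (V H : hilbertType R) (j : {linear V -> H})
    (a : sesquilinear_form V) : set (H * H) :=
  [set xf | exists2 u : V, j u = xf.1 & forall v : V, a u v = inner xf.2 (j v)].

Definition opp_operator (H : hilbertType R) (A : set (H * H)) : set (H * H) :=
  [set xf | A (xf.1, - xf.2)].

(* Only the values of S at t > 0 are relevant, here and below. *)
Definition C0_semigroup (H : hilbertType R) (S : R -> {linear H -> H}) : Prop :=
  [/\ forall t : R, 0 < t -> continuous (S t),
      forall s t : R, 0 < s -> 0 < t -> forall x, S (s + t) x = S s (S t x)
    & forall x, S t x @[t --> 0^'+] --> x].

Definition generator (H : hilbertType R) (S : R -> {linear H -> H}) :
    set (H * H) :=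
  [set xf | t^-1%:C *: (S t xf.1 - xf.1) @[t --> 0^'+] --> xf.2].

Definition semigroup_generated_by (H : hilbertType R) (S : R -> {linear H -> H})
    (B : set (H * H)) : Prop :=
  C0_semigroup S /\ generator S = B.

Definition unitary (H1 H2 : hilbertType R) (Phi : {linear H1 -> H2}) : Prop :=
  [/\ continuous Phi, bijective Phi
    & forall x y : H1, inner (Phi x) (Phi y) = inner x y].

End Forms.

(* Main.v *)
(* The semigroup and the operator determine each other, and the operator
   determines the form. If Phi intertwines the semigroups, it maps the graph of
   A1 onto that of A2, so the two forms agree on D(A1). By Lax-Milgram, applied
   to the shifted form and to its adjoint, D(A1) is dense in V1; ellipticity
   makes the norms of V1 and V2 equivalent on D(A1), so Phi extends from D(A1)
   to V1 by completeness, and the same applies to the inverse of Phi.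

   Conversely, if the forms agree then Phi maps the graph of A1 into that of
   A2, and for x in D(A1) the difference u(t) = Phi S1(t) x - S2(t) Phi x solves
   u' = - A2 u, u(0) = 0. As A2 is quasi-accretive, |u|^2 has right derivative
   at most 2 omega |u|^2, hence vanishes. The left continuity of u that this
   needs comes from Baire's theorem (uniform boundedness of S(t) near 0).

   A sesquilinear form and an inner product are recovered from their real parts
   by replacing v with i v, so most of the argument is carried out with real
   parts, regarding a complex Hilbert space as a real one. *)

From HB Require Import structures.
Require Import Defs.
From mathcomp Require Import all_boot all_order all_algebra.
From mathcomp Require Import complex.
From mathcomp Require Import all_classical all_reals all_analysis.
From mathcomp Require Import ring lra.

Import Order.TTheory GRing.Theory Num.Theory.
Import numFieldNormedType.Exports.

Local Open Scope classical_set_scope.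
Local Open Scope ring_scope.

(** * The real inner product underlying a complex Hilbert space *)

Section RealPart.
Set Implicit Arguments.
Unset Strict Implicit.
Local Open Scope complex_scope.
Context {R : realType}.
Implicit Types (H V : hilbertType R).

Definition rdot {H} (x y : H) : R := complex.Re (inner x y).

(** The norm takes values in [R[i]]; being a nonnegative real there, it is determined by its real
    part. *)
Definition rnorm {H} (x : H) : R := complex.Re `|x|.

Lemma Re_numE (z : R[i]) : 'Re z = (complex.Re z)%:C.
Proof. by rewrite ReJ_add Num.Theory.ReE. Qed.

Lemma normE H (x : H) : `|x| = (rnorm x)%:C.
Proof. by rewrite /rnorm RRe_real ?normr_real. Qed.

Lemma rnorm_ge0 H (x : H) : 0 <= rnorm x.
Proof. by rewrite -lecR -normE normr_ge0. Qed.

Lemma rdotxx H (x : H) : rdot x x = rnorm x ^+ 2.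
Proof. by rewrite /rdot -normr_inner normE -rmorphXn. Qed.

Lemma ReZ (r : R) (z : R[i]) : complex.Re (r%:C * z) = r * complex.Re z.
Proof. by case: z => a b /=; rewrite mul0r subr0. Qed.

Lemma rdotDl H (x y z : H) : rdot (x + y) z = rdot x z + rdot y z.
Proof. by rewrite /rdot linearDl raddfD. Qed.

Lemma rdotDr H (x y z : H) : rdot z (x + y) = rdot z x + rdot z y.
Proof. by rewrite /rdot linearDr raddfD. Qed.

Lemma rdotZl H (r : R) (x z : H) : rdot (r%:C *: x) z = r * rdot x z.
Proof. by rewrite /rdot linearZl_LR ReZ. Qed.

Lemma rdotZr H (r : R) (x z : H) : rdot z (r%:C *: x) = r * rdot z x.
Proof.
rewrite /rdot linearZr_LR /=.
have -> : Num.conj (r%:C : R[i]) = r%:C by exact: conjc_real.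
by rewrite ReZ.
Qed.

Lemma rdotC H (x y : H) : rdot x y = rdot y x.
Proof.
rewrite /rdot hermC expr0 mul1r.
have Re_conj (z : R[i]) : complex.Re (Num.conj z) = complex.Re z by case: z.
exact: Re_conj.
Qed.

Lemma rdotNl H (x z : H) : rdot (- x) z = - rdot x z.
Proof. by rewrite /rdot linearNl raddfN. Qed.

Lemma rdotNr H (x z : H) : rdot z (- x) = - rdot z x.
Proof. by rewrite rdotC rdotNl rdotC. Qed.

Lemma rnorm_triangle H (x y : H) : rnorm (x + y) <= rnorm x + rnorm y.
Proof. by have := ler_normD x y; rewrite !normE -rmorphD lecR. Qed.

Lemma rnormN H (x : H) : rnorm (- x) = rnorm x.
Proof. by rewrite /rnorm normrN. Qed.

Lemma rnormZ H (r : R) (x : H) : rnorm (r%:C *: x) = `|r| * rnorm x.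
Proof.
rewrite /rnorm normrZ normc_def /= expr0n addr0 sqrtr_sqr.
by rewrite ReZ.
Qed.

Lemma rnorm_eq0 H (x : H) : rnorm x = 0 -> x = 0.
Proof. by move=> x0; apply/normr0_eq0; rewrite normE x0. Qed.

Lemma rnorm0 H : rnorm (0 : H) = 0.
Proof. by rewrite /rnorm normr0. Qed.

Lemma rnormB H (x y : H) : rnorm (x - y) = rnorm (y - x).
Proof. by rewrite -rnormN opprB. Qed.

Lemma rnorm_sqD H (x y : H) :
  rnorm (x + y) ^+ 2 = rnorm x ^+ 2 + 2 * rdot x y + rnorm y ^+ 2.
Proof. by rewrite -!rdotxx rdotDl !rdotDr (rdotC y x); ring. Qed.

(** At t = B / (A + 1) the quadratic equals - B^2 (A + 2) / (A + 1)^2; the denominator A + 1 also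
    covers A = 0. *)
Lemma quadratic_ge0_linear0 (A B : R) : 0 <= A ->
  (forall t : R, 0 <= t ^+ 2 * A - 2 * t * B) -> B = 0.
Proof.
move=> A0 /(_ (B / (A + 1))).
have A1 : 0 < A + 1 by lra.
rewrite (_ : _ - _ = - (B ^+ 2 * ((A + 2) / (A + 1) ^+ 2))); last first.
  by field; rewrite gt_eqF.
rewrite oppr_ge0 pmulr_lle0; last by rewrite divr_gt0 ?exprn_gt0//; lra.
by move=> B0; apply/eqP; rewrite -sqrf_eq0 eq_le B0 sqr_ge0.
Qed.

(** Cauchy-Schwarz, read off from the square of the triangle inequality. *)
Lemma rdot_le H (x y : H) : rdot x y <= rnorm x * rnorm y.
Proof.
have := rnorm_triangle x y; have := rnorm_sqD x y.
have := rnorm_ge0 x; have := rnorm_ge0 y; have := rnorm_ge0 (x + y).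
set a := rnorm x; set b := rnorm y; set c := rnorm (x + y).
nra.
Qed.

Lemma gt0_complexP (e : R[i]) : 0 < e -> exists2 r : R, 0 < r & e = r%:C.
Proof.
move=> e0; exists (complex.Re e); last by rewrite RRe_real ?gtr0_real.
by move: e0; rewrite ltcE => /andP[].
Qed.

Lemma cvg_rnormP H {T} {F : set_system T} {FF : Filter F} (f : T -> H) (l : H) :
  f @ F --> l <-> forall e : R, 0 < e -> \forall t \near F, rnorm (f t - l) < e.
Proof.
split => [/cvgrPdist_lt h e e0|h].
  have := h e%:C; rewrite ltcR => /(_ e0); apply: filterS => t.
  by rewrite normE ltcR rnormB.
apply/cvgrPdist_lt => _ /gt0_complexP[e e0 ->].
by apply: filterS (h e e0) => t; rewrite normE rnormB ltcR.
Qed.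

Lemma rcomplete H (u : nat -> H) :
  (forall e : R, 0 < e -> exists N, forall m n, (N <= m)%N -> (N <= n)%N ->
     rnorm (u m - u n) < e) ->
  exists l : H, u @ \oo --> l.
Proof.
move=> h; suff ucvg : cvg (u @ \oo) by exists (lim (u @ \oo)).
apply/cauchy_cvgP/cauchy_exP => _ /gt0_complexP[e e0 ->].
have [N hN] := h e e0; exists (u N); exists N => // n /= Nn.
by rewrite -ball_normE /= normE ltcR hN.
Qed.

End RealPart.

(** * Riesz representation and the Lax-Milgram theorem *)

Section RealHilbert.
Set Implicit Arguments.
Unset Strict Implicit.
Local Open Scope complex_scope.
Context {R : realType}.
Implicit Types (H V : hilbertType R).

Lemma le_of_le_add_eps (x y : R) : (forall e : R, 0 < e -> x <= y + e) -> x <= y.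
Proof. by move=> h; apply/ler_addgt0Pr. Qed.

Lemma exists_inv_lt (e : R) : 0 < e ->
  exists N, forall n, (N <= n)%N -> n.+1%:R^-1 < e.
Proof.
move=> e0; exists (Num.truncn e^-1) => n Nn.
rewrite invf_plt ?posrE//.
by apply: lt_le_trans (truncnS_gt _) _; rewrite ler_nat.
Qed.

Definition real_subspace V (W : set V) :=
  W 0 /\ forall (r : R) x y, W x -> W y -> W (r%:C *: x + y).

Definition real_functional V (l : V -> R) :=
  forall (r : R) x y, l (r%:C *: x + y) = r * l x + l y.

Definition bounded_functional V (l : V -> R) :=
  exists2 M : R, 0 < M & forall x, `|l x| <= M * rnorm x.

Lemma real_functional0 V (l : V -> R) : real_functional l -> l 0 = 0.
Proof. by move=> /(_ (- 1) 0 0); rewrite scaler0 addr0 mulN1r addNr. Qed.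

Lemma real_functionalZ V (l : V -> R) : real_functional l ->
  forall r x, l (r%:C *: x) = r * l x.
Proof.
by move=> lin r x; have := lin r x 0; rewrite (real_functional0 lin) !addr0.
Qed.

Lemma real_functionalB V (l : V -> R) : real_functional l ->
  forall x y, l (x - y) = l x - l y.
Proof.
move=> lin x y.
have -> : x - y = (- 1)%:C *: y + x by rewrite rmorphN1 scaleN1r addrC.
by rewrite lin mulN1r addrC.
Qed.

Lemma rdot_norm_le H (x y : H) : `|rdot x y| <= rnorm x * rnorm y.
Proof.
by rewrite ler_norml rdot_le andbT lerNl -rdotNl -[in leRHS]rnormN rdot_le.
Qed.

Lemma rdot_norm_le1 H (x y : H) : `|rdot x y| <= (rnorm x + 1) * rnorm y.
Proof.
apply: le_trans (rdot_norm_le _ _) _.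
by rewrite ler_wpM2r ?rnorm_ge0 ?lerDl.
Qed.

(* [w] is the residual [v - p], where [p] is the limit of a minimizing sequence
   for the distance from [v] to [W]. *)
Lemma real_subspace_dense V (W : set V) : real_subspace W ->
  (forall w, (forall x, W x -> rdot w x = 0) -> w = 0) ->
  forall (v : V) (e : R), 0 < e -> exists2 x, W x & rnorm (v - x) < e.
Proof.
move=> [W0 Wlin] Worth v.
pose D := [set rnorm (v - x) | x in W]; pose d := inf D.
have D_lb : lbound D 0 by move=> _ [x _ <-]; exact: rnorm_ge0.
have D_inf : has_inf D by split; [exists (rnorm (v - 0)), 0 | exists 0].
have d0 : 0 <= d by apply: lb_le_inf => //; case: D_inf.
have dle x : W x -> d <= rnorm (v - x).
  by move=> Wx; apply: ge_inf; [case: D_inf | exists x].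
have /choice[u hu] n : exists x, W x /\ rnorm (v - x) < d + n.+1%:R^-1.
  have [|_ [x Wx <-] hx] := @inf_adherent _ D n.+1%:R^-1 _ D_inf.
    by rewrite invr_gt0 ltr0Sn.
  by exists x.
have par (e : R) : 0 < e -> exists N, forall m n, (N <= m)%N -> (N <= n)%N ->
    rnorm (u m - u n) < e.
  move=> e0.
  (* With i, j the two reciprocals, the parallelogram identity and the midpoint bound give |u m - u
     n|^2 <= 2 (d + i)^2 + 2 (d + j)^2 - 4 d^2 <= (4 d + 2) (i + j), using i^2 <= i and j^2 <= j;
     this is less than e^2. *)
  have [|N hN] := @exists_inv_lt (Num.min 1 (e ^+ 2 / (8 * d + 5))).
    by rewrite lt_min ltr01 divr_gt0 ?exprn_gt0//; lra.
  exists N => m n /hN + /hN; rewrite !lt_min => /andP[m1 me] /andP[n1 ne].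
  have [[Wm vm] [Wn vn]] := (hu m, hu n).
  have Wmid : W (2^-1%:C *: (u m + u n)).
    rewrite -[_ *: _]addr0; apply: (Wlin _ _ 0) => //.
    by rewrite -[u m]scale1r; apply: (Wlin 1).
  have := dle _ Wmid.
  have : 4 * rnorm (v - 2^-1%:C *: (u m + u n)) ^+ 2 + rnorm (u m - u n) ^+ 2 =
         2 * rnorm (v - u m) ^+ 2 + 2 * rnorm (v - u n) ^+ 2.
    rewrite -!rdotxx !(rdotDl, rdotDr, rdotNl, rdotNr, rdotZl, rdotZr).
    rewrite (rdotC (u m) v) (rdotC (u n) v) (rdotC (u m) (u n)).
    by field.
  move: m1 me n1 ne vm vn; rewrite !ltr_pdivlMr; try lra.
  have := rnorm_ge0 (v - u m); have := rnorm_ge0 (v - u n).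
  set i := m.+1%:R^-1; set j := n.+1%:R^-1.
  have : 0 < i by rewrite invr_gt0 ltr0Sn.
  have : 0 < j by rewrite invr_gt0 ltr0Sn.
  set a := rnorm (v - u m); set b := rnorm (v - u n).
  set c := rnorm (v - _); set x := rnorm (u m - u n).
  move=> j0 i0 b0 a0 i1 ie j1 je adi bdj E dc.
  have x0 : 0 <= x by exact: rnorm_ge0.
  rewrite -(ltr_pXn2r (n := 2)) ?nnegrE ?(ltW e0)//.
  have : a ^+ 2 <= (d + i) ^+ 2 by rewrite lerXn2r ?nnegrE; lra.
  have : b ^+ 2 <= (d + j) ^+ 2 by rewrite lerXn2r ?nnegrE; lra.
  have : d ^+ 2 <= c ^+ 2 by rewrite lerXn2r ?nnegrE; lra.
  have : i ^+ 2 <= i by rewrite expr2; nra.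
  have : j ^+ 2 <= j by rewrite expr2; nra.
  nra.
have [p /cvg_rnormP up] := rcomplete par.
have wle : rnorm (v - p) <= d.
  apply: le_of_le_add_eps => e e0.
  have [N _ hN] := up (e / 2) (divr_gt0 e0 (ltr0n _ 2)).
  have [|M hM] := @exists_inv_lt (e / 2); first by rewrite divr_gt0.
  have := hN (maxn N M) (leq_maxl _ _); have := hM (maxn N M) (leq_maxr _ _).
  have [_] := hu (maxn N M); set n := maxn N M.
  have := rnorm_triangle (v - u n) (u n - p); rewrite addrA subrK /=.
  set i := n.+1%:R^-1.
  lra.
(* As |v - p| <= d <= |v - p - r x| for every real r, squaring yields a nonnegative quadratic in r,
   so its linear coefficient [rdot (v - p) x] vanishes. *)
have vp : v - p = 0.
  apply: Worth => x Wx.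
  apply: (@quadratic_ge0_linear0 _ (rnorm x ^+ 2)).
    by rewrite exprn_ge0 ?rnorm_ge0.
  move=> r.
  have : d <= rnorm (v - p + (- r)%:C *: x).
    apply: le_of_le_add_eps => e e0.
    have [N _ /(_ N (leqnn N))] := up e e0.
    have [Wu _] := hu N.
    have := dle _ (Wlin r _ _ Wx Wu).
    have := rnorm_triangle (v - p + (- r)%:C *: x) (p - u N).
    rewrite (_ : _ + (p - u N) = v - (r%:C *: x + u N)); last first.
      by rewrite rmorphN scaleNr opprD addrACA subrK.
    rewrite (rnormB p) /=. lra.
  rewrite -(ler_pXn2r (n := 2)) ?nnegrE ?rnorm_ge0// rnorm_sqD.
  rewrite rnormZ rdotZr normrN exprMn real_normK ?num_real//.
  have : rnorm (v - p) ^+ 2 <= d ^+ 2 by rewrite lerXn2r ?nnegrE ?rnorm_ge0.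
  lra.
move=> e e0; have [N _ /(_ N (leqnn N))] := up e e0.
by have [Wu _] := hu N; exists (u N) => //; rewrite (subr0_eq vp) rnormB.
Qed.

(** If l is nonzero, its kernel is not dense, by boundedness. Hence some nonzero w is orthogonal to
    the kernel, and a multiple of w represents l. *)
Lemma riesz V (l : V -> R) : real_functional l -> bounded_functional l ->
  exists f, forall v, l v = rdot f v.
Proof.
move=> lin [M M0 lM].
have l0 := real_functional0 lin; have lB := real_functionalB lin.
have lZ := real_functionalZ lin.
case: (pselect (forall v, l v = 0)) => [lz|/existsNP[v0 lv0]].
  by exists 0 => v; rewrite lz /rdot linear0l raddf0.
pose W := [set x | l x = 0].
have Wsub : real_subspace W.
  by split=> // r x y; rewrite /W /= lin => -> ->; rewrite mulr0 addr0.
case: (pselect (forall w, (forall x, W x -> rdot w x = 0) -> w = 0)).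
  move=> /(real_subspace_dense Wsub)/(_ v0 (`|l v0| / M)) [|x Wx].
    by rewrite divr_gt0 ?normr_gt0//; apply/eqP.
  rewrite ltr_pdivlMr// mulrC ltNge; have := lM (v0 - x).
  by rewrite lB Wx subr0 => ->.
move=> /existsNP[w /not_implyP[worth wn0]].
have ww : rdot w w != 0.
  rewrite rdotxx sqrf_eq0; apply/eqP => /rnorm_eq0; exact: wn0.
have lw : l w != 0.
  by apply/eqP => lw; move/eqP: ww; apply; exact: worth.
exists ((l w / rdot w w)%:C *: w) => v.
have : W (v - (l v / l w)%:C *: w) by rewrite /W /= lB lZ divfK // subrr.
move=> /worth; rewrite rdotDr rdotNr rdotZr => /subr0_eq wv.
by rewrite rdotZl wv; field; rewrite lw.
Qed.

(** By Riesz each [b u] is represented by some w, and l by some f. Coercivity makes the set of such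
    w dense, and makes the preimages u n of approximants w n of f a Cauchy sequence; its limit is
    the solution. *)
Lemma lax_milgram V (b : V -> V -> R) (alpha : R) :
  (forall u, real_functional (b u)) ->
  (forall v, real_functional (b^~ v)) ->
  (exists2 M : R, 0 < M & forall u v, `|b u v| <= M * rnorm u * rnorm v) ->
  0 < alpha -> (forall u, alpha * rnorm u ^+ 2 <= b u u) ->
  forall l : V -> R, real_functional l -> bounded_functional l ->
  exists u, forall v, b u v = l v.
Proof.
move=> br bl [M M0 bM] a0 coer l ll lb.
have [f lf] := riesz ll lb.
have T_ex u : exists w, forall v, b u v = rdot w v.
  apply: riesz (br u) _; exists (M * (rnorm u + 1)).
    by rewrite mulr_gt0// ltr_wpDl ?rnorm_ge0.
  move=> v; apply: le_trans (bM _ _) _.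
  by rewrite ler_wpM2r ?rnorm_ge0// ler_wpM2l ?(ltW M0)// lerDl.
pose W := [set w | exists u, forall v, b u v = rdot w v].
have Wsub : real_subspace W.
  split.
    by exists 0 => v; rewrite (real_functional0 (bl v)) /rdot linear0l raddf0.
  move=> r x y [u hu] [u' hu']; exists (r%:C *: u + u') => v.
  by rewrite (bl v) hu hu' rdotDl rdotZl.
have Wdense := real_subspace_dense Wsub.
(* A vector w orthogonal to the range is orthogonal to the representative of [b w], so b w w = 0. *)
have /Wdense/(_ f) fW : forall w, (forall x, W x -> rdot w x = 0) -> w = 0.
  move=> w worth; have [x hx] := T_ex w.
  have := worth x (ex_intro _ w hx); rewrite rdotC -hx => bww.
  apply: rnorm_eq0; apply/eqP; rewrite -sqrf_eq0 eq_le sqr_ge0 andbT.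
  by rewrite -(pmulr_rle0 _ a0) -bww.
have /choice[uw huw] n : exists uw : V * V, (forall v, b uw.1 v = rdot uw.2 v) /\
    rnorm (f - uw.2) < n.+1%:R^-1.
  have [|w [u hu] hw] := fW n.+1%:R^-1; first by rewrite invr_gt0 ltr0Sn.
  by exists (u, w).
pose u n := (uw n).1; pose w n := (uw n).2.
have uwE n v : b (u n) v = rdot (w n) v by have [] := huw n.
have wf n : rnorm (f - w n) < n.+1%:R^-1 by have [] := huw n.
have ucauchy (e : R) : 0 < e -> exists N, forall m n, (N <= m)%N -> (N <= n)%N ->
    rnorm (u m - u n) < e.
  move=> e0; have [|N hN] := @exists_inv_lt (alpha * e / 2).
    by rewrite divr_gt0 ?mulr_gt0.
  exists N => m n /hN Nm /hN Nn.
  have := coer (u m - u n).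
  rewrite (real_functionalB (bl _)) !uwE -rdotNl -rdotDl => le1.
  have := le_trans le1 (rdot_le _ _).
  have : rnorm (w m - w n) < alpha * e.
    have := rnorm_triangle (w m - f) (f - w n); rewrite addrA subrK.
    have := lt_trans (wf m) Nm; have := lt_trans (wf n) Nn.
    by rewrite (rnormB (w m)); lra.
  have := rnorm_ge0 (w m - w n); have := rnorm_ge0 (u m - u n).
  set x := rnorm (u m - u n); set y := rnorm (w m - w n) => x0 y0 yae axy.
  rewrite ltNge; apply/negP => ex.
  have : alpha * x <= y.
    have xp : 0 < x by lra.
    by rewrite -(ler_pM2r xp) -mulrA -expr2.
  nra.
have [p /cvg_rnormP up] := rcomplete ucauchy.
exists p => v; rewrite lf; apply/eqP; rewrite -subr_eq0 -normr_le0.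
apply: le_of_le_add_eps => e e0; rewrite add0r.
(* One tolerance e / ((M + 1) (|v| + 1)) serves both error terms, M |p - u n| |v| and |f - w n|
   |v|. *)
have K0 : 0 < (M + 1) * (rnorm v + 1).
  by rewrite mulr_gt0 ?ltr_wpDl ?rnorm_ge0 ?(ltW M0).
have e'0 : 0 < e / ((M + 1) * (rnorm v + 1)) by rewrite divr_gt0.
have [N1 _ hN1] := up _ e'0; have [N2 hN2] := exists_inv_lt e'0.
set n := maxn N1 N2.
have un := hN1 n (leq_maxl _ _); have wn := lt_trans (wf n) (hN2 n (leq_maxr _ _)).
have -> : b p v - rdot f v = b (p - u n) v - rdot (f - w n) v.
  by rewrite (real_functionalB (bl v)) uwE rdotDl rdotNl; ring.
have le1 := bM (p - u n) v.
have le2 : `|rdot (f - w n) v| <= rnorm (f - w n) * rnorm v.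
  exact: rdot_norm_le.
apply: le_trans (ler_normB _ _) _.
move: un wn le1 le2; rewrite /= (rnormB (u n) p).
have := divfK (lt0r_neq0 K0) e; set q := e / _ => eE.
have := rnorm_ge0 v; set z := rnorm v => z0 xq yq le1 le2.
have : M * rnorm (p - u n) * z <= M * q * z.
  by rewrite ler_wpM2r// ler_wpM2l ?(ltW xq) ?(ltW M0).
have : rnorm (f - w n) * z <= q * z by rewrite ler_wpM2r ?(ltW yq).
have q0 : 0 < q by exact: e'0.
have : 0 < q * M by rewrite mulr_gt0.
have : e = M * q * z + q * M + q * z + q by rewrite -eE; ring.
lra.
Qed.

End RealHilbert.

(** * Elliptic forms *)

Section Forms.
Set Implicit Arguments.
Unset Strict Implicit.
Local Open Scope complex_scope.
Context {R : realType}.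
Implicit Types (H V : hilbertType R).

Lemma near_rnormP H (x : H) (P : set H) : nbhs x P ->
  exists2 d : R, 0 < d & forall y, rnorm (y - x) < d -> P y.
Proof.
move=> /nbhs_ballP[_ /gt0_complexP[d d0 ->] dP]; exists d => // y yx.
by apply: dP; rewrite -ball_normE /= normE ltcR rnormB.
Qed.

(** Continuity at 0 gives d with |f y| < 1 for |y| < d; rescaling x to norm d / 2 yields the
    constant 2 / d. *)
Lemma continuous_linear_rnorm H1 H2 (f : {linear H1 -> H2}) : continuous f ->
  exists2 M : R, 0 < M & forall x, rnorm (f x) <= M * rnorm x.
Proof.
move=> fc; have /cvg_rnormP/(_ 1 ltr01) := fc 0.
move=> /near_rnormP[d d0 fd]; exists (2 / d); first by rewrite divr_gt0.
move=> x; have [->|x0] := eqVneq x 0; first by rewrite linear0 !rnorm0 mulr0.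
have xp : 0 < rnorm x.
  by rewrite lt_def rnorm_ge0 andbT; apply: contra_neq x0 => /rnorm_eq0.
have := fd ((d / 2 / rnorm x)%:C *: x).
rewrite /= (linear0 f) !subr0 linearZ/= !rnormZ gtr0_norm ?divr_gt0//.
rewrite divfK ?gt_eqF// ltr_pdivrMr// ltr_pMr// ltr1n => /(_ isT).
rewrite -ltr_pdivlMl ?divr_gt0// mulr1 => /ltW/le_trans; apply.
by rewrite le_eqVlt; apply/orP; left; apply/eqP; field; rewrite !gt_eqF.
Qed.

Definition rform V (a : sesquilinear_form V) (u v : V) : R := complex.Re (a u v).

Lemma rform_functionalr V (a : sesquilinear_form V) u : real_functional (rform a u).
Proof.
move=> r x y; rewrite /rform linearDr linearZr_LR /= raddfD /=.
have -> : Num.conj (r%:C : R[i]) = r%:C by exact: conjc_real.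
by rewrite ReZ.
Qed.

Lemma rform_functionall V (a : sesquilinear_form V) v :
  real_functional (rform a ^~ v).
Proof. by move=> r x y; rewrite /rform linearDl linearZl_LR /= raddfD /= ReZ. Qed.

Lemma Re_rotate (z : R[i]) : complex.Re (Num.conj 'i%C * z) = complex.Im z.
Proof. by case: z => x y /=; rewrite mul0r sub0r mulN1r opprK. Qed.

(* The imaginary part is recovered from the real one by rotating [v]. *)
Lemma rform_inj V1 V2 (a1 : sesquilinear_form V1) (a2 : sesquilinear_form V2)
    u1 v1 u2 v2 :
  rform a1 u1 v1 = rform a2 u2 v2 ->
  rform a1 u1 ('i%C *: v1) = rform a2 u2 ('i%C *: v2) -> a1 u1 v1 = a2 u2 v2.
Proof.
rewrite /rform !linearZr_LR /= !Re_rotate => re im.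
by apply/eqP; rewrite eq_complex re im !eqxx.
Qed.

(** Continuity at (0, 0), with each variable rescaled separately. *)
Lemma rform_bounded V (a : sesquilinear_form V) : continuous_form a ->
  exists2 M : R, 0 < M & forall u v, `|rform a u v| <= M * rnorm u * rnorm v.
Proof.
move=> ac; have /cvgrPdist_lt/(_ 1 ltr01) := ac (0, 0).
move=> [[A B] /= [/near_rnormP[d d0 dA] /near_rnormP[e e0 eB]] AB].
exists (2 / d * (2 / e)); first by rewrite !mulr_gt0 ?invr_gt0.
move=> u v; have [->|u0] := eqVneq u 0.
  by rewrite (real_functional0 (rform_functionall a v)) rnorm0 normr0 !(mulr0, mul0r).
have [->|v0] := eqVneq v 0.
  by rewrite (real_functional0 (rform_functionalr a u)) rnorm0 normr0 !(mulr0, mul0r).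
have up : 0 < rnorm u.
  by rewrite lt_def rnorm_ge0 andbT; apply: contra_neq u0 => /rnorm_eq0.
have vp : 0 < rnorm v.
  by rewrite lt_def rnorm_ge0 andbT; apply: contra_neq v0 => /rnorm_eq0.
pose r := d / 2 / rnorm u; pose s := e / 2 / rnorm v.
have r0 : 0 < r by rewrite !divr_gt0.
have s0 : 0 < s by rewrite !divr_gt0.
have Au : A (r%:C *: u).
  apply: dA; rewrite subr0 rnormZ gtr0_norm// divfK ?gt_eqF//; lra.
have Bv : B (s%:C *: v).
  apply: eB; rewrite subr0 rnormZ gtr0_norm// divfK ?gt_eqF//; lra.
have := AB (r%:C *: u, s%:C *: v) (conj Au Bv).
rewrite /= linear0l sub0r normrN => lt1.
have := le_lt_trans (normc_ge_Re _) lt1; rewrite ltcR -/(rform _ _ _).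
rewrite (real_functionalZ (rform_functionalr a _)).
rewrite (real_functionalZ (rform_functionall a _)) mulrA normrM.
rewrite (gtr0_norm (mulr_gt0 s0 r0)).
rewrite -(ltr_pdivlMl _ _ (mulr_gt0 s0 r0)) mulr1 => /ltW/le_trans; apply.
rewrite le_eqVlt; apply/orP; left; apply/eqP; rewrite /r /s; field.
by rewrite !gt_eqF.
Qed.

Lemma elliptic_rform V H (j : {linear V -> H}) (a : sesquilinear_form V) :
  elliptic j a -> exists omega mu : R, 0 < mu /\
    forall u, mu * rnorm u ^+ 2 <= rform a u u + omega * rnorm (j u) ^+ 2.
Proof.
move=> [omega [mu [mu0 ell]]]; exists omega, mu; split=> // u.
by have := ell u; rewrite !normE Re_numE -!rmorphXn -!rmorphM -rmorphD lecR.
Qed.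

(** The operator domain as a subset of V, because its density is wanted in the norm of V. *)
Definition rdomain V H (j : {linear V -> H}) (a : sesquilinear_form V) : set V :=
  [set u | exists f, forall v, rform a u v = rdot f (j v)].

(** Real parts suffice: testing with i v as well as v recovers the imaginary parts. *)
Lemma associated_operatorP V H (j : {linear V -> H}) (a : sesquilinear_form V) x f :
  associated_operator j a (x, f) <->
  exists2 u, j u = x & forall v, rform a u v = rdot f (j v).
Proof.
split=> -[u /= ux uf]; exists u => //= v; first by rewrite /rform uf.
have := uf ('i%C *: v); rewrite /rform /rdot.
rewrite (linearZ_LR j) !linearZr_LR /= !Re_rotate => im.
by apply/eqP; rewrite eq_complex im -/(rform _ _ _) uf !eqxx.
Qed.

Lemma rdomain_subspace V H (j : {linear V -> H}) (a : sesquilinear_form V) :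
  real_subspace (rdomain j a).
Proof.
split; first by exists 0 => v; rewrite /rform /rdot !linear0l.
move=> r x y [f xf] [g yg]; exists (r%:C *: f + g) => v.
by rewrite rform_functionall xf yg rdotDl rdotZl.
Qed.

(* [w'] represents the functional [rdot w] through the adjoint of the shifted
   form, so that [w] orthogonal to the domain forces [j w'] to be orthogonal
   to the range of the shifted operator, which is everything. *)
Lemma rdomain_dense V H (j : {linear V -> H}) (a : sesquilinear_form V) :
  dense_embedding j -> continuous_form a -> elliptic j a ->
  forall (v : V) (e : R), 0 < e -> exists2 x, rdomain j a x & rnorm (v - x) < e.
Proof.
move=> [jinj jcont _] ac /elliptic_rform[omega [mu [mu0 ell]]].
have [M M0 aM] := rform_bounded ac.
have [K K0 jK] := continuous_linear_rnorm jcont.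
have Dsub := @rdomain_subspace _ _ j a.
apply: real_subspace_dense => // w worth.
pose b u v := rform a u v + omega * rdot (j u) (j v).
have br u : real_functional (b u).
  move=> r x y; rewrite /b rform_functionalr linearD linearZ/= rdotDr rdotZr.
  by ring.
have bl v : real_functional (b^~ v).
  move=> r x y; rewrite /b rform_functionall linearD linearZ/= rdotDl rdotZl.
  by ring.
have bM : exists2 N : R, 0 < N & forall u v, `|b u v| <= N * rnorm u * rnorm v.
  exists (M + `|omega| * K ^+ 2).
    by rewrite ltr_pwDl// mulr_ge0// exprn_ge0// ltW.
  move=> u v; apply: le_trans (ler_normD _ _) _; rewrite !mulrDl lerD//.
  rewrite normrM -!mulrA ler_wpM2l//.
  apply: le_trans (rdot_norm_le _ _) _.
  apply: le_trans (ler_pM (rnorm_ge0 _) (rnorm_ge0 _) (jK _) (jK _)) _.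
  by lra.
have bcoer u : mu * rnorm u ^+ 2 <= b u u by rewrite /b rdotxx ell.
have [w' bw'] : exists w', forall u, b u w' = rdot w u.
  apply: (@lax_milgram _ _ (fun u v => b v u) mu) => //.
  - by have [N N0 bN] := bM; exists N => // u v; rewrite mulrAC.
  - by move=> r x y; rewrite rdotDr rdotZr.
  - by exists (rnorm w + 1); [rewrite ltr_wpDl ?rnorm_ge0 | exact: rdot_norm_le1].
have [u bu] : exists u, forall v, b u v = rdot (j w') (j v).
  apply: (@lax_milgram _ _ b mu) => //.
    by move=> r x y; rewrite linearD linearZ/= rdotDr rdotZr.
  exists ((rnorm (j w') + 1) * K); first by rewrite mulr_gt0 ?ltr_wpDl ?rnorm_ge0.
  move=> v; apply: le_trans (rdot_norm_le1 _ _) _.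
  by rewrite -mulrA ler_wpM2l ?addr_ge0 ?rnorm_ge0.
(* The choice of u means (A + omega) u = j w', so A u = j w' - omega j u. *)
have uD : rdomain j a u.
  exists (j w' - omega%:C *: j u) => v.
  by rewrite rdotDl rdotNl rdotZl -bu /b; ring.
have : rdot (j w') (j w') = 0 by rewrite -bu bw'; exact: worth.
rewrite rdotxx => /eqP; rewrite sqrf_eq0 => /eqP/rnorm_eq0 jw'.
have w'0 : w' = 0 by apply: jinj; rewrite jw' linear0.
apply/rnorm_eq0/eqP; rewrite -sqrf_eq0 -rdotxx -bw' w'0.
by rewrite (real_functional0 (br w)).
Qed.

End Forms.

(** * Transfer of the form along an isometry *)

Section Transfer.
Set Implicit Arguments.
Unset Strict Implicit.
Local Open Scope complex_scope.
Context {R : realType}.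
Implicit Types (H V : hilbertType R).

Lemma isometry_rdot H1 H2 (Phi : {linear H1 -> H2}) :
  (forall x y, inner (Phi x) (Phi y) = inner x y) ->
  forall x y, rdot (Phi x) (Phi y) = rdot x y.
Proof. by move=> iso x y; rewrite /rdot iso. Qed.

Lemma isometry_rnorm H1 H2 (Phi : {linear H1 -> H2}) :
  (forall x y, inner (Phi x) (Phi y) = inner x y) ->
  forall x, rnorm (Phi x) = rnorm x.
Proof.
move=> iso x; apply/eqP; rewrite -(eqrXn2 (n := 2)) ?rnorm_ge0//.
by rewrite -!rdotxx isometry_rdot.
Qed.

(* On the operator domain the two forms agree, hence so do their energy norms
   up to constants; a Cauchy sequence in the domain of [A1] is thus mapped to
   one in [V2], and the domain is dense in [V1]. *)
Lemma form_transfer H1 H2 V1 V2 (j1 : {linear V1 -> H1}) (j2 : {linear V2 -> H2})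
    (a1 : sesquilinear_form V1) (a2 : sesquilinear_form V2)
    (Phi : {linear H1 -> H2}) :
  dense_embedding j1 -> dense_embedding j2 ->
  continuous_form a1 -> continuous_form a2 ->
  elliptic j1 a1 -> elliptic j2 a2 ->
  (forall x y, inner (Phi x) (Phi y) = inner x y) ->
  (forall x f, associated_operator j1 a1 (x, f) ->
     associated_operator j2 a2 (Phi x, Phi f)) ->
  (forall u, exists u', j2 u' = Phi (j1 u)) /\
  (forall u v u' v', j2 u' = Phi (j1 u) -> j2 v' = Phi (j1 v) ->
     a2 u' v' = a1 u v).
Proof.
move=> hj1 [j2inj j2cont _] a1c a2c ell1 ell2 iso graph.
have Dense := rdomain_dense hj1 a1c ell1.
have [Dom0 Domlin] := @rdomain_subspace _ _ _ j1 a1.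
case: hj1 => _ j1cont _.
have [M1 M10 a1M] := rform_bounded a1c; have [M2 M20 a2M] := rform_bounded a2c.
have [K1 K10 j1K] := continuous_linear_rnorm j1cont.
have [K2 K20 j2K] := continuous_linear_rnorm j2cont.
have [omega [mu [mu0 coer]]] := elliptic_rform ell2.
have isor := isometry_rdot iso; have ison := isometry_rnorm iso.
have domP u : rdomain j1 a1 u -> exists2 u', j2 u' = Phi (j1 u) &
    forall v v', j2 v' = Phi (j1 v) -> rform a2 u' v' = rform a1 u v.
  move=> [f hf]; have : associated_operator j1 a1 (j1 u, f).
    by apply/associated_operatorP; exists u.
  move=> /graph/associated_operatorP[u' u'E hu']; exists u' => // v v' v'E.
  by rewrite hu' v'E isor hf.
(* Ellipticity of [a2] and the bounds on [a1] and [j1] give |u'|^2 <= (C - 1) |u|^2; the added 1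
   ensures C >= 1, so that C - 1 <= C^2 and no square root is taken. *)
pose C := (M1 + `|omega| * K1 ^+ 2) / mu + 1.
have C0 : 0 < C.
  by rewrite ltr_wpDl// divr_ge0 ?(ltW mu0)// addr_ge0 ?(ltW M10)// mulr_ge0// sqr_ge0.
have domB u u' : rdomain j1 a1 u -> j2 u' = Phi (j1 u) -> rnorm u' <= C * rnorm u.
  move=> /domP[w wE hw] u'E; have {w wE hw} hw : forall v v', j2 v' = Phi (j1 v) ->
      rform a2 u' v' = rform a1 u v.
    by have <- : w = u' by apply: j2inj; rewrite wE u'E.
  have := coer u'; rewrite (hw _ _ u'E) u'E ison.
  have := a1M u u; have := j1K u; have := rnorm_ge0 u'; have := rnorm_ge0 u.
  have := rnorm_ge0 (j1 u).
  set x := rnorm u; set y := rnorm u'; set z := rnorm (j1 u) => z0 x0 y0 zx ax cy.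
  rewrite -(ler_pXn2r (n := 2)) ?nnegrE ?mulr_ge0 ?(ltW C0)//.
  have z2 : z ^+ 2 <= (K1 * x) ^+ 2 by rewrite lerXn2r ?nnegrE// mulr_ge0 ?(ltW K10).
  have oz : omega * z ^+ 2 <= `|omega| * (K1 * x) ^+ 2.
    apply: le_trans (ler_wpM2r (sqr_ge0 _) (ler_norm _)) _.
    by rewrite ler_wpM2l.
  have le1 : mu * y ^+ 2 <= (M1 + `|omega| * K1 ^+ 2) * x ^+ 2.
    by have := le_trans (ler_norm _) ax; lra.
  have le2 : y ^+ 2 <= (C - 1) * x ^+ 2.
    by rewrite /C addrK mulrAC ler_pdivlMr// mulrC.
  apply: le_trans le2 _; rewrite exprMn ler_wpM2r ?sqr_ge0//.
  have C1 : 1 <= C.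
    by rewrite lerDr divr_ge0 ?(ltW mu0)// addr_ge0 ?(ltW M10)// mulr_ge0// sqr_ge0.
  nra.
have domsub u v : rdomain j1 a1 u -> rdomain j1 a1 v -> rdomain j1 a1 (u - v).
  move=> Du Dv; have := Domlin (- 1) _ _ Dv Du.
  by rewrite rmorphN1 scaleN1r addrC.
(* The lift of u is the limit of lifts of domain elements tending to u, which are Cauchy by [domB].
   The approximants are recorded for the form identity. *)
have limP u : exists2 u', j2 u' = Phi (j1 u) & forall e : R, 0 < e ->
    exists w w', [/\ rdomain j1 a1 w, j2 w' = Phi (j1 w),
      rnorm (u - w) < e & rnorm (u' - w') < e].
  have /choice[ww hww] n : exists ww : V1 * V2, [/\ rdomain j1 a1 ww.1,
      j2 ww.2 = Phi (j1 ww.1) & rnorm (u - ww.1) < n.+1%:R^-1].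
    have [|w Dw uw] := Dense u n.+1%:R^-1; first by rewrite invr_gt0 ltr0Sn.
    by have [w' w'E _] := domP w Dw; exists (w, w').
  pose w n := (ww n).1; pose w' n := (ww n).2.
  have Dw n : rdomain j1 a1 (w n) by have [] := hww n.
  have w'E n : j2 (w' n) = Phi (j1 (w n)) by have [] := hww n.
  have uw n : rnorm (u - w n) < n.+1%:R^-1 by have [] := hww n.
  have cauchy_w' (e : R) : 0 < e -> exists N, forall m n, (N <= m)%N -> (N <= n)%N ->
      rnorm (w' m - w' n) < e.
    move=> e0; have [|N hN] := @exists_inv_lt _ (e / C / 2).
      by rewrite !divr_gt0.
    exists N => m n /hN Nm /hN Nn.
    apply: le_lt_trans (domB (w m - w n) _ _ _) _; first exact: domsub.
      by rewrite !linearB /= !w'E.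
    rewrite mulrC -ltr_pdivlMr//.
    have := rnorm_triangle (w m - u) (u - w n); rewrite addrA subrK (rnormB (w m)).
    have := lt_trans (uw m) Nm; have := lt_trans (uw n) Nn; lra.
  have [p /cvg_rnormP wp] := rcomplete cauchy_w'.
  have approx (e : R) : 0 < e ->
      exists n, rnorm (u - w n) < e /\ rnorm (p - w' n) < e.
    move=> e0; have [N1 _ hN1] := wp _ e0; have [N2 hN2] := exists_inv_lt e0.
    exists (maxn N1 N2); split.
      exact: lt_trans (uw _) (hN2 _ (leq_maxr _ _)).
    by rewrite rnormB; exact: hN1 (leq_maxl _ _).
  exists p; last first.
    by move=> e /approx[n [un pn]]; exists (w n), (w' n).
  apply/subr0_eq/rnorm_eq0/le_anti; rewrite rnorm_ge0 andbT.
  apply: le_of_le_add_eps => e e0; rewrite add0r.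
  have [|n [un pn]] := approx (e / (K1 + K2)); first by rewrite divr_gt0 ?addr_gt0.
  have -> : j2 p - Phi (j1 u) = j2 (p - w' n) - Phi (j1 (u - w n)).
    by rewrite (linearB j2) (linearB j1) (linearB Phi) /= w'E opprB addrA subrK.
  apply: le_trans (rnorm_triangle _ _) _; rewrite rnormN ison.
  have := j2K (p - w' n); have := j1K (u - w n).
  move: un pn; rewrite !ltr_pdivlMr ?addr_gt0//.
  nra.
have Re_eq u v u' v' : j2 u' = Phi (j1 u) -> j2 v' = Phi (j1 v) ->
    rform a2 u' v' = rform a1 u v.
  move=> u'E v'E; have [p pE papprox] := limP u.
  have {pE p papprox} papprox : forall e : R, 0 < e ->
    exists w w', [/\ rdomain j1 a1 w, j2 w' = Phi (j1 w),
      rnorm (u - w) < e & rnorm (u' - w') < e].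
    by have <- : p = u' by apply: j2inj; rewrite pE u'E.
  apply/eqP; rewrite -subr_eq0 -normr_le0.
  apply: le_of_le_add_eps => e e0; rewrite add0r.
  (* Replacing u', u by domain approximants within e / K changes the two form values by at most e in
     total. *)
  pose K := M2 * rnorm v' + M1 * rnorm v + 1.
  have K0 : 0 < K.
    by rewrite ltr_wpDl// addr_ge0// mulr_ge0 ?rnorm_ge0// ltW.
  have [|w [w' [/domP[w'' w''E hw] w'E uw uw']]] := papprox (e / K).
    by rewrite divr_gt0.
  have {}hw : rform a2 w' v' = rform a1 w v.
    by have <- : w'' = w' by [apply: j2inj; rewrite w''E w'E]; exact: hw.
  have -> : rform a2 u' v' - rform a1 u v =
      rform a2 (u' - w') v' - rform a1 (u - w) v.
    rewrite (real_functionalB (rform_functionall a2 v')).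
    by rewrite (real_functionalB (rform_functionall a1 v)) hw; ring.
  apply: le_trans (ler_normB _ _) _.
  have := a2M (u' - w') v'; have := a1M (u - w) v.
  have -> : e = M2 * (e / K) * rnorm v' + M1 * (e / K) * rnorm v + e / K.
    by rewrite /K; field; rewrite gt_eqF.
  have q0 : 0 < e / K by rewrite divr_gt0.
  have : M2 * rnorm (u' - w') * rnorm v' <= M2 * (e / K) * rnorm v'.
    by rewrite ler_wpM2r ?rnorm_ge0// ler_wpM2l ?(ltW M20) ?(ltW uw').
  have : M1 * rnorm (u - w) * rnorm v <= M1 * (e / K) * rnorm v.
    by rewrite ler_wpM2r ?rnorm_ge0// ler_wpM2l ?(ltW M10) ?(ltW uw).
  move: q0; set q := e / K; lra.
split=> [u|u v u' v' u'E v'E]; first by have [u' u'E _] := limP u; exists u'.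
apply: rform_inj; apply: Re_eq => //.
by rewrite !linearZ /= v'E.
Qed.

End Transfer.

(** * Semigroups *)

Section Semigroups.
Set Implicit Arguments.
Unset Strict Implicit.
Local Open Scope complex_scope.
Context {R : realType}.
Implicit Types (H V : hilbertType R).

Lemma near_right0P (P : set R) : (\forall h \near 0^'+, P h) ->
  exists2 d : R, 0 < d & forall h, 0 < h -> h < d -> P h.
Proof.
move=> /nbhs_ballP[d /= d0 dP]; exists d => // h h0 hd.
by apply: dP => //; rewrite /ball /= sub0r normrN gtr0_norm.
Qed.

(** Baire's theorem by nested closed balls: every ball contains a smaller ball inside U n, and the
    centres converge to the common point. *)
Lemma baire_rnorm H (U : nat -> set H) :
  (forall n x (r : R), 0 < r -> exists y (r' : R), 0 < r' /\
    forall z, rnorm (z - y) < r' -> rnorm (z - x) < r /\ U n z) ->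
  exists p, forall n, U n p.
Proof.
move=> step.
have /choice[f hf] (ns : nat * (H * R)) : exists s : H * R, 0 < ns.2.2 ->
    [/\ 0 < s.2, s.2 <= ns.1.+1%:R^-1 & forall z, rnorm (z - s.1) <= s.2 ->
      rnorm (z - ns.2.1) < ns.2.2 /\ U ns.1 z].
  case: ns => n [x r] /=; case: (pselect (0 < r)) => [r0|nr]; last by exists (x, r).
  have [y [r' [r'0 hr']]] := step n x r r0.
  (* Halving r' puts the closed ball inside the open one; the second entry makes the radii tend to
     0. *)
  exists (y, Num.min (r' / 2) n.+1%:R^-1) => _ /=; split.
  - by rewrite lt_min divr_gt0//= invr_gt0 ltr0Sn.
  - by rewrite ge_min lexx orbT.
  - move=> z; rewrite le_min => /andP[zy _]; apply: hr'; lra.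
pose s := fix s n := if n is m.+1 then f (m, s m) else (0, 1).
have s0 n : 0 < (s n).2.
  by elim: n => [|n IH] /=; [exact: ltr01 | have [] := hf (n, s n) IH].
pose B n z := rnorm (z - (s n).1) <= (s n).2.
have BS n z : B n.+1 z -> B n z /\ U n z.
  have [_ _ h] := hf (n, s n) (s0 n).
  by move=> /h[/ltW ? ?].
have Bm n m : (n <= m)%N -> forall z, B m z -> B n z.
  elim: m => [|m IH]; first by rewrite leqn0 => /eqP->.
  by rewrite leq_eqVlt => /predU1P[->//|/IH h] z /BS[/h].
have Bc n m : (n <= m)%N -> B n (s m).1.
  by move=> /Bm; apply; rewrite /B subrr rnorm0 ltW.
have s_cauchy (e : R) : 0 < e -> exists N, forall m n, (N <= m)%N -> (N <= n)%N ->
    rnorm ((s m).1 - (s n).1) < e.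
  move=> e0; have [|N hN] := @exists_inv_lt _ (e / 2); first by rewrite divr_gt0.
  exists N.+1 => m n Nm Nn.
  have [_ /= rN _] := hf (N, s N) (s0 N).
  have := hN N (leqnn N); have := Bc _ _ Nm; have := Bc _ _ Nn; rewrite /B.
  have := rnorm_triangle ((s m).1 - (s N.+1).1) ((s N.+1).1 - (s n).1).
  rewrite addrA subrK (rnormB (s N.+1).1) /=; move: rN; set i := N.+1%:R^-1.
  lra.
have [p /cvg_rnormP sp] := rcomplete s_cauchy.
exists p => n; suff /BS[] : B n.+1 p by [].
apply: le_of_le_add_eps => e e0; have [N _ hN] := sp e e0.
have := hN (maxn N n.+1) (leq_maxl _ _); have := Bc n.+1 _ (leq_maxr N _).
set m := maxn _ _; rewrite /B.
have := rnorm_triangle (p - (s m).1) ((s m).1 - (s n.+1).1).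
rewrite addrA subrK (rnormB p (s m).1) /=; lra.
Qed.

(** Otherwise every U n below is open and dense, and a point p common to all of them contradicts S t
    p -> p. *)
Lemma semigroup_locally_bounded H (S : R -> {linear H -> H}) : C0_semigroup S ->
  exists M d : R, [/\ 0 < M, 0 < d &
    forall t, 0 < t -> t < d -> forall x, rnorm (S t x) <= M * rnorm x].
Proof.
move=> [Scont _ S0]; apply: contrapT => unb.
have {unb} unb (M d : R) : 0 < M -> 0 < d ->
    exists t x, [/\ 0 < t, t < d & M * rnorm x < rnorm (S t x)].
  move=> M0 d0; apply: contrapT => nex; apply: unb; exists M, d; split=> // t t0 td x.
  by rewrite leNgt; apply/negP => lt; apply: nex; exists t, x.
pose U (n : nat) := [set z |
  exists t, [/\ 0 < t, t < n.+1%:R^-1 & n%:R < rnorm (S t z)]].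
have [n x r r0|p hp] := @baire_rnorm H U.
  have i0 : 0 < n.+1%:R^-1 :> R by rewrite invr_gt0 ltr0Sn.
  have [y [yx [t [t0 tn yn]]]] : exists y, rnorm (y - x) < r / 2 /\ U n y.
    apply: contrapT => nex.
    have small t y : 0 < t -> t < n.+1%:R^-1 -> rnorm (y - x) < r / 2 ->
        rnorm (S t y) <= n%:R.
      move=> t0 tn yx; rewrite leNgt; apply/negP => lt.
      by apply: nex; exists y; split=> //; exists t.
    (* With c = r / (4 |z|) this constant gives |c S t z| > 2 n + 1, whereas S t (c z + x) and S t x
       both have norm at most n. *)
    have M0 : 0 < (2 * n%:R + 1) * (4 / r) :> R.
      by rewrite mulr_gt0 ?divr_gt0// ltr_wpDl.
    have [t [z [t0 tn zM]]] := unb _ _ M0 i0.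
    have zp : 0 < rnorm z.
      rewrite lt_def rnorm_ge0 andbT; apply/eqP => z0.
      by move: zM; rewrite (rnorm_eq0 z0) linear0 !rnorm0 mulr0 ltxx.
    pose c := r / 4 / rnorm z.
    have c0 : 0 < c by rewrite /c divr_gt0 ?divr_gt0.
    have := small t (c%:C *: z + x) t0 tn.
    rewrite addrK rnormZ gtr0_norm// divfK ?gt_eqF// => /(_ ltac:(lra)).
    have := small t x t0 tn; rewrite subrr rnorm0 => /(_ ltac:(lra)).
    have := rnorm_triangle (S t (c%:C *: z + x)) (- S t x).
    rewrite -linearB addrK linearZ /= rnormZ gtr0_norm// rnormN.
    have : c * ((2 * n%:R + 1) * (4 / r) * rnorm z) < c * rnorm (S t z).
      by rewrite ltr_pM2l.
    have -> : c * ((2 * n%:R + 1) * (4 / r) * rnorm z) = 2 * n%:R + 1.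
      by rewrite /c; field; rewrite !gt_eqF.
    lra.
  have [K K0 SK] := continuous_linear_rnorm (Scont t t0).
  (* The same t is a witness for all z near y: moving y by less than (|S t y| - n) / K keeps |S t z|
     above n. *)
  exists y, (Num.min (r / 2) ((rnorm (S t y) - n%:R) / K)); split.
    by rewrite lt_min !divr_gt0// subr_gt0.
  move=> z; rewrite lt_min => /andP[zy]; rewrite ltr_pdivlMr// => zyK; split.
    by have := rnorm_triangle (z - y) (y - x); rewrite addrA subrK; lra.
  exists t; split=> //; have := rnorm_triangle (S t (y - z)) (S t z).
  rewrite -linearD subrK; have := SK (y - z); rewrite (rnormB y); lra.
have /cvg_rnormP/(_ 1 ltr01)/near_right0P[d d0 hd] := S0 p.
have [N hN] := exists_inv_lt d0.
pose m := maxn N (Num.truncn (rnorm p + 1)).+1.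
have [t [t0 tm]] := hp m.
have := hd t t0 (lt_trans tm (hN m (leq_maxl _ _))).
have := rnorm_triangle (S t p - p) p; rewrite subrK.
have : rnorm p + 1 < m%:R.
  by apply: lt_le_trans (truncnS_gt _) _; rewrite ler_nat leq_maxr.
rewrite /=; lra.
Qed.

(** Write S t x - S s x = S s (S (t - s) x - x) and S s = S (s - (t - r)) S (t - r) with r fixed:
    the first factor is uniformly bounded, the second is one bounded operator. *)
Lemma orbit_left_continuous H (S : R -> {linear H -> H}) : C0_semigroup S ->
  forall (t : R) x (e : R), 0 < t -> 0 < e -> exists2 d : R, 0 < d & d <= t /\
    forall s, t - d < s -> s < t -> rnorm (S t x - S s x) < e.
Proof.
move=> CS t x e t0 e0; have [M [d [M0 d0 bound]]] := semigroup_locally_bounded CS.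
have [Scont SD S0] := CS.
pose r := Num.min d t / 2.
have r0 : 0 < r by rewrite divr_gt0// lt_min d0.
have [rd rt] : 2 * r <= d /\ 2 * r <= t.
  by rewrite /r mulrC divfK// !ge_min !lexx orbT.
have tr0 : 0 < t - r by lra.
have [K K0 SK] := continuous_linear_rnorm (Scont _ tr0).
have e'0 : 0 < e / (M * K) by rewrite divr_gt0// mulr_gt0.
have /cvg_rnormP/(_ _ e'0)/near_right0P[d' d'0 hd'] := S0 x.
exists (Num.min r d'); first by rewrite lt_min r0.
split; first by rewrite ge_min; apply/orP; left; lra.
move=> s; rewrite ltrBlDr -ltrBlDl lt_min => /andP[sr sd] st.
have sr0 : 0 < s - (t - r) by lra.
have ts0 : 0 < t - s by lra.
have s0 : 0 < s by lra.
have -> : S t x = S s (S (t - s) x) by rewrite -SD// addrC subrK.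
rewrite -linearB; set z := _ - x.
have -> : S s z = S (s - (t - r)) (S (t - r) z) by rewrite -SD// subrK.
apply: le_lt_trans (bound _ sr0 _ _) _; first by lra.
have := hd' _ ts0 sd; rewrite /= -/z ltr_pdivlMr ?mulr_gt0//.
have := SK z; have := rnorm_ge0 (S (t - r) z) => z0 zK.
by apply: le_lt_trans; have := ler_wpM2l (ltW M0) zK; lra.
Qed.

(** * Generators, Gronwall's inequality and uniqueness of orbits *)

Lemma generatorP H (S : R -> {linear H -> H}) x y : generator S (x, y) ->
  forall e : R, 0 < e -> exists2 d : R, 0 < d & forall h, 0 < h -> h < d ->
    rnorm (h^-1%:C *: (S h x - x) - y) < e.
Proof. by move=> /= /cvg_rnormP xy e /xy/near_right0P. Qed.

Lemma generator_continuous_image H1 H2 (S1 : R -> {linear H1 -> H1})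
    (S2 : R -> {linear H2 -> H2}) (Phi : {linear H1 -> H2}) :
  continuous Phi -> (forall t x, 0 < t -> S2 t (Phi x) = Phi (S1 t x)) ->
  forall x y, generator S1 (x, y) -> generator S2 (Phi x, Phi y).
Proof.
move=> Pc comm x y /= xy.
have : Phi (t^-1%:C *: (S1 t x - x)) @[t --> 0^'+] --> Phi y.
  by apply: continuous_cvg => //; exact: Pc.
apply: cvg_trans; apply: near_eq_cvg; near=> t.
by rewrite linearZ linearB comm.
Unshelve. all: by end_near. Qed.

Lemma generator_orbit H (S : R -> {linear H -> H}) : C0_semigroup S ->
  forall (t : R) x y, 0 < t -> generator S (x, y) -> generator S (S t x, S t y).
Proof.
move=> [Scont SD _] t x y t0; apply: (@generator_continuous_image _ _ S S (S t)).
  exact: Scont.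
by move=> s z s0; rewrite -!SD// addrC.
Qed.

Lemma generatorB H (S : R -> {linear H -> H}) x y x' y' :
  generator S (x, y) -> generator S (x', y') -> generator S (x - x', y - y').
Proof.
move=> /= xy xy'.
have : t^-1%:C *: (S t x - x) - t^-1%:C *: (S t x' - x') @[t --> 0^'+] --> y - y'.
  exact: cvgB.
apply: cvg_trans; apply: near_eq_cvg.
near=> t; rewrite /= -scalerBr (linearB (S t)); congr (_ *: _).
by rewrite !opprD !opprK addrACA.
Unshelve. all: by end_near. Qed.

(* [eps * exp ((c + 1) t)] is a strict supersolution that [f] cannot cross. *)
Lemma gronwall_right (f : R -> R) (c : R) : 0 <= c -> f 0 = 0 ->
  (forall t e : R, 0 <= t -> 0 < e -> exists2 d : R, 0 < d &
    forall h, 0 < h -> h < d -> f (t + h) <= f t + h * (c * f t + e)) ->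
  (forall t e : R, 0 < t -> 0 < e -> exists2 d : R, 0 < d & d <= t /\
    forall s, t - d < s -> s < t -> f t <= f s + e) ->
  forall t, 0 <= t -> f t <= 0.
Proof.
move=> c0 f0 fr fl.
suff main (eps t : R) : 0 < eps -> 0 <= t -> f t <= eps * expR ((c + 1) * t).
  move=> t t0; apply: le_of_le_add_eps => e e0; rewrite add0r.
  have := main (e / expR ((c + 1) * t)) t; rewrite divfK ?gt_eqF ?expR_gt0//.
  by apply=> //; rewrite divr_gt0 ?expR_gt0.
move=> eps0 t0; pose g s := eps * expR ((c + 1) * s).
have g0 s : 0 < g s by rewrite mulr_gt0 ?expR_gt0.
have gmono s s' : s <= s' -> g s <= g s'.
  by move=> ss'; rewrite ler_pM2l// ler_expR ler_wpM2l//; lra.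
rewrite -/(g t) leNgt; apply/negP => gft.
(* Continuation: f <= g holds up to m = sup E by the left condition and slightly beyond m by the
   growth bound, contradicting the choice of m. *)
pose E := [set r | 0 <= r /\ r <= t /\ forall s : R, 0 <= s -> s <= r -> f s <= g s].
have E0 : E 0.
  split; [exact: lexx | split=> //] => s s0 s0'.
  have -> : s = 0 by apply/le_anti; rewrite s0 s0'.
  by rewrite f0 ltW.
have Eub : has_ubound E by exists t => r [_ []].
have Esup : has_sup E by split=> //; exists 0.
pose m := sup E.
have m0 : 0 <= m by exact: ub_le_sup.
have mt : m <= t by apply: ge_sup; [exists 0 | move=> r [_ []]].
have below s : 0 <= s -> s < m -> f s <= g s.
  move=> s0 sm; have ms : 0 < m - s by rewrite subr_gt0.
  have [r [_ [_ hr]]] := sup_adherent ms Esup.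
  by rewrite -/m opprB addrC subrK => /ltW; exact: hr.
have fm : f m <= g m.
  move: m0; rewrite le_eqVlt => /predU1P[<-|m0]; first by rewrite f0 ltW.
  apply: le_of_le_add_eps => e e0; have [d d0 [dm hd]] := fl m e m0 e0.
  apply: le_trans (hd (m - d / 2) _ _) _; [lra|lra|].
  rewrite lerD2r; apply: le_trans (below _ _ _) (gmono _ _ _); lra.
(* With slack g m the growth bound becomes f (m + h) <= g m (1 + (c + 1) h) <= g (m + h). *)
have [d d0 hd] := fr m (g m) m0 (g0 m).
have above h : 0 < h -> h < d -> f (m + h) <= g (m + h).
  move=> h0 /(hd h h0)/le_trans; apply.
  have -> : g (m + h) = g m * expR ((c + 1) * h) by rewrite /g mulrDr expRD mulrA.
  have exp1 : g m * (1 + (c + 1) * h) <= g m * expR ((c + 1) * h).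
    by rewrite ler_wpM2l ?expR_ge1Dx// ltW.
  apply: le_trans exp1.
  have cfg : h * (c * f m) <= h * (c * g m) by rewrite ler_pM2l// ler_wpM2l.
  lra.
have mlt : m < t.
  by rewrite lt_def mt andbT; apply/eqP => tm; move: gft; rewrite tm ltNge fm.
pose h := Num.min (d / 2) (t - m).
have h0 : 0 < h by rewrite lt_min divr_gt0// subr_gt0.
have [hd2 htm] : h <= d / 2 /\ h <= t - m by rewrite !ge_min !lexx orbT.
have : E (m + h).
  split; first by lra.
  split; first by lra.
  move=> s s0 smh; case: (ltgtP s m) => [sm|ms|->//]; first exact: below.
  have -> : s = m + (s - m) by ring.
  by apply: above; lra.
by move=> /(ub_le_sup Eub); rewrite -/m; lra.
Qed.

Lemma rnorm_sq_growth H (q : R -> H) (u u' : H) (omega : R) :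
  rdot u u' <= omega * rnorm u ^+ 2 ->
  (forall e : R, 0 < e -> exists2 d : R, 0 < d &
    forall h, 0 < h -> h < d -> rnorm (q h - u') < e) ->
  forall e : R, 0 < e -> exists2 d : R, 0 < d & forall h, 0 < h -> h < d ->
    rnorm (u + h%:C *: q h) ^+ 2 <=
      rnorm u ^+ 2 + h * (2 * omega * rnorm u ^+ 2 + e).
Proof.
move=> diss qu' e e0.
have u0 := rnorm_ge0 u; have u'0 := rnorm_ge0 u'.
(* The 1 bounds |q h| by |u'| + 1; the other entry keeps [rdot u (q h)] within e / 4 of [rdot u u'].
   The bound on h then gives h |q h|^2 <= e / 2. *)
have e'0 : 0 < Num.min 1 (e / 4 / (rnorm u + 1)).
  by rewrite lt_min ltr01 !divr_gt0// ltr_wpDl.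
have [d d0 hd] := qu' _ e'0.
exists (Num.min d (e / 2 / (rnorm u' + 1) ^+ 2)).
  by rewrite lt_min d0 !divr_gt0// exprn_gt0// ltr_wpDl.
move=> h h0; rewrite lt_min => /andP[/(hd h h0)].
rewrite lt_min => /andP[q1]; rewrite ltr_pdivlMr ?ltr_wpDl// => qe.
rewrite ltr_pdivlMr ?exprn_gt0 ?ltr_wpDl// => he.
rewrite rnorm_sqD rdotZr rnormZ gtr0_norm// exprMn.
have := rdot_le u (q h - u'); rewrite rdotDr rdotNr.
have := rnorm_triangle (q h - u') u'; rewrite subrK.
have := rnorm_ge0 (q h - u'); have := rnorm_ge0 (q h).
move: diss q1 qe he; set a := rnorm u; set b := rnorm u'; set y := rnorm (q h - u').
set z := rnorm (q h); set p := rdot u u'; set p' := rdot u (q h).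
move=> diss y1 ye he z0 y0 zb pp.
have z2 : z ^+ 2 <= (b + 1) ^+ 2.
  by rewrite lerXn2r ?nnegrE ?addr_ge0//; lra.
have : h * z ^+ 2 <= h * (b + 1) ^+ 2 by rewrite ler_pM2l.
have : p' <= omega * a ^+ 2 + e / 4 by nra.
move=> le1 le2; have : h * (2 * p' + h * z ^+ 2) <= h * (2 * omega * a ^+ 2 + e).
  by rewrite ler_pM2l//; lra.
by lra.
Qed.

(* The difference [u] of the two orbits solves [u' = B2 u], [u 0 = 0]; since
   [B2] is quasi-dissipative, Gronwall's inequality gives [u = 0]. *)
Lemma semigroup_intertwine H1 H2 (S1 : R -> {linear H1 -> H1})
    (S2 : R -> {linear H2 -> H2}) (Phi : {linear H1 -> H2}) (omega : R) :
  C0_semigroup S1 -> C0_semigroup S2 -> continuous Phi ->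
  (forall x y, generator S1 (x, y) -> generator S2 (Phi x, Phi y)) ->
  0 <= omega ->
  (forall x y, generator S2 (x, y) -> rdot x y <= omega * rnorm x ^+ 2) ->
  (forall x (e : R), 0 < e ->
    exists x' y', generator S1 (x', y') /\ rnorm (x - x') < e) ->
  forall t x, 0 < t -> S2 t (Phi x) = Phi (S1 t x).
Proof.
move=> CS1 CS2 Pc gen omega0 diss dense_dom.
have [S1c S1D _] := CS1; have [S2c S2D _] := CS2.
have [K K0 PK] := continuous_linear_rnorm Pc.
suff on_dom x y t : generator S1 (x, y) -> 0 < t -> S2 t (Phi x) = Phi (S1 t x).
  move=> t x t0; apply/subr0_eq/rnorm_eq0/le_anti; rewrite rnorm_ge0 andbT.
  apply: le_of_le_add_eps => e e0; rewrite add0r.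
  have [M1 M10 S1M] := continuous_linear_rnorm (S1c t t0).
  have [M2 M20 S2M] := continuous_linear_rnorm (S2c t t0).
  have L0 : 0 < M2 * K + K * M1 by rewrite addr_gt0 ?mulr_gt0.
  have [|x' [y' [xy' xx']]] := dense_dom x (e / (M2 * K + K * M1)).
    by rewrite divr_gt0.
  have -> : S2 t (Phi x) - Phi (S1 t x) =
      S2 t (Phi (x - x')) - Phi (S1 t (x - x')).
    rewrite (linearB (S1 t)) !(linearB Phi) (linearB (S2 t)) /=.
    by rewrite (on_dom _ _ _ xy' t0) opprB addrA subrK.
  apply: le_trans (rnorm_triangle _ _) _; rewrite rnormN.
  have := S2M (Phi (x - x')); have := PK (S1 t (x - x')).
  have := ler_wpM2l (ltW M20) (PK (x - x')); have := ler_wpM2l (ltW K0) (S1M (x - x')).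
  by move: xx'; rewrite ltr_pdivlMr//; lra.
move=> xy t0.
(* [S1] and [S2] are constrained at positive times only, so the initial value 0, the limit at 0, is
   imposed. *)
pose U s := if s <= 0 then 0 else Phi (S1 s x) - S2 s (Phi x).
have Upos s : 0 < s -> U s = Phi (S1 s x) - S2 s (Phi x).
  by move=> s0; rewrite /U leNgt s0.
have U0 : U 0 = 0 by rewrite /U lexx.
suff : rnorm (U t) ^+ 2 <= 0.
  rewrite Upos// => le0; apply/esym/subr0_eq/rnorm_eq0/eqP.
  by rewrite -sqrf_eq0 eq_le le0 sqr_ge0.
apply: (@gronwall_right (fun s => rnorm (U s) ^+ 2) (2 * omega)); last exact: ltW.
- by rewrite mulr_ge0.
- by rewrite U0 rnorm0 expr0n.
- move=> s e s0 e0.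
  have [u' diss_u' qu'] : exists2 u', rdot (U s) u' <= omega * rnorm (U s) ^+ 2 &
      forall e : R, 0 < e -> exists2 d : R, 0 < d & forall h, 0 < h -> h < d ->
        rnorm (h^-1%:C *: (U (s + h) - U s) - u') < e.
    (* This treats s = 0 and s > 0 alike: after time s, U is a difference of orbits starting at
       domain elements, with right derivative Phi a' - b' at s. *)
    have [a [a' [b [b' [aa' bb' Us Ush]]]]] : exists a a' b b',
        [/\ generator S1 (a, a'), generator S2 (b, b'), U s = Phi a - b &
          forall h, 0 < h -> U (s + h) = Phi (S1 h a) - S2 h b].
      move: s0; rewrite le_eqVlt => /predU1P[<-|s0].
        exists x, y, (Phi x), (Phi y); split=> //; first exact: gen.
          by rewrite U0 subrr.
        by move=> h h0; rewrite add0r Upos.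
      exists (S1 s x), (S1 s y), (S2 s (Phi x)), (S2 s (Phi y)); split.
      - exact: generator_orbit.
      - by apply: generator_orbit => //; exact: gen.
      - exact: Upos.
      - by move=> h h0; rewrite addrC Upos ?addr_gt0// S1D// S2D.
    exists (Phi a' - b').
      by rewrite Us; apply: diss; apply: generatorB => //; exact: gen.
    move=> {}e {}e0; have [|d1 d10 h1] := generatorP aa' (e := e / (2 * K)).
      by rewrite divr_gt0 ?mulr_gt0.
    have [|d2 d20 h2] := generatorP bb' (e := e / 2); first by rewrite divr_gt0.
    exists (Num.min d1 d2); first by rewrite lt_min d10.
    move=> h h0; rewrite lt_min => /andP[/(h1 h h0) + /(h2 h h0)].
    set v1 := _ - a'; set v2 := _ - b'.
    have -> : h^-1%:C *: (U (s + h) - U s) - (Phi a' - b') = Phi v1 - v2.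
      rewrite Us Ush// /v1 /v2 (linearB Phi) (linearZ_LR Phi) (linearB Phi) /=.
      rewrite [in RHS]opprD opprK addrACA -scalerBr; congr (_ *: _ + _).
        by rewrite !opprD !opprK addrACA.
      by rewrite opprD opprK.
    rewrite ltr_pdivlMr ?mulr_gt0// => le1 le2.
    apply: le_lt_trans (rnorm_triangle _ _) _; rewrite rnormN.
    have := PK v1; lra.
  have [d d0 hd] := rnorm_sq_growth diss_u' qu' e0.
  exists d => // h h0 /(hd h h0); rewrite scalerA -rmorphM mulfV ?gt_eqF//.
  by rewrite scale1r [U s + _]addrC subrK.
- move=> s e s0 e0; set a := rnorm (U s).
  have a0 : 0 <= a by exact: rnorm_ge0.
  have a10 : 0 < 2 * a + 1 by lra.
  (* For e = e' (2 a + 1) and b >= 0, the bound a <= b + e' implies a^2 <= b^2 + e, which passes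
     from norms to squares. *)
  have e'0 : 0 < e / (2 * a + 1) by rewrite divr_gt0.
  have e''0 : 0 < e / (2 * a + 1) / (2 * K).
    by apply: divr_gt0 => //; rewrite mulr_gt0.
  have e20 : 0 < e / (2 * a + 1) / 2 by rewrite divr_gt0.
  have [d1 d10 [d1s h1]] := orbit_left_continuous CS1 x s0 e''0.
  have [d2 d20 [d2s h2]] := orbit_left_continuous CS2 (Phi x) s0 e20.
  exists (Num.min d1 d2); first by rewrite lt_min d10.
  split; first by rewrite ge_min d1s.
  move=> r; rewrite ltrBlDr -ltrBlDl lt_min => /andP[sr1 sr2] rs.
  have r0 : 0 < r by lra.
  have := h1 r ltac:(lra) rs; have := h2 r ltac:(lra) rs.
  set v1 := S1 s x - _; set v2 := S2 s _ - _ => v2e.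
  rewrite ltr_pdivlMr ?mulr_gt0// => v1e.
  have : rnorm (U s) <= rnorm (U r) + e / (2 * a + 1).
    have -> : U s = U r + (Phi v1 - v2).
      rewrite !Upos// /v1 /v2 (linearB Phi) /= opprB addrACA.
      by rewrite addKr [Phi (S1 r x) + _]addrC subrK.
    apply: le_trans (rnorm_triangle _ _) _; rewrite lerD2l.
    apply: le_trans (rnorm_triangle _ _) _; rewrite rnormN.
    have := PK v1; lra.
  have ee : e / (2 * a + 1) * (2 * a + 1) = e by rewrite divfK ?gt_eqF.
  have := rnorm_ge0 (U r); rewrite -/a.
  move: e'0 ee; set e' := e / _; set b := rnorm (U r) => e'0 ee b0 ab.
  case: (leP a e') => ae; first by nra.
  have : (a - e') ^+ 2 <= b ^+ 2 by rewrite lerXn2r ?nnegrE; lra.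
  by nra.
Qed.

End Semigroups.

(** * Semigroups generated by elliptic forms *)

Section FormSemigroups.
Set Implicit Arguments.
Unset Strict Implicit.
Local Open Scope complex_scope.
Context {R : realType}.
Implicit Types (H V : hilbertType R).

Lemma dense_embedding_approx V H (j : {linear V -> H}) : dense_embedding j ->
  forall x (e : R), 0 < e -> exists u, rnorm (x - j u) < e.
Proof.
move=> [_ _ jdense] x e e0.
have e0C : 0 < e%:C by rewrite ltcR.
have [|y [xy [u _ uy]]] := jdense (ball x e%:C) _ (ball_open x _).
  by exists x; exact: ballxx.
by exists u; move: xy; rewrite uy -ball_normE /= normE ltcR.
Qed.

(** For x = j u one has [rdot x y] = - Re a(u, u), bounded through ellipticity; |omega| replaces
    omega because Gronwall's inequality is applied with a nonnegative constant. *)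
Lemma generated_dissipative V H (j : {linear V -> H}) (a : sesquilinear_form V)
    (S : R -> {linear H -> H}) :
  elliptic j a -> semigroup_generated_by S (opp_operator (associated_operator j a)) ->
  exists2 omega : R, 0 <= omega &
    forall x y, generator S (x, y) -> rdot x y <= omega * rnorm x ^+ 2.
Proof.
move=> /elliptic_rform[omega [mu [mu0 ell]]] [_ genS].
exists `|omega|; first exact: normr_ge0.
move=> x y; rewrite genS => /associated_operatorP /= [u <- /(_ u)].
rewrite rdotNl rdotC => auu.
have := ell u; have := sqr_ge0 (rnorm u); have := ler_norm omega.
have := sqr_ge0 (rnorm (j u)); nra.
Qed.

(** Density of the domain in V passes to H, since j is bounded with dense range. *)
Lemma generated_domain_dense V H (j : {linear V -> H}) (a : sesquilinear_form V)
    (S : R -> {linear H -> H}) :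
  dense_embedding j -> continuous_form a -> elliptic j a ->
  semigroup_generated_by S (opp_operator (associated_operator j a)) ->
  forall x (e : R), 0 < e ->
    exists x' y', generator S (x', y') /\ rnorm (x - x') < e.
Proof.
move=> hj ac ell [_ genS] x e e0.
have [_ jcont _] := hj; have [K K0 jK] := continuous_linear_rnorm jcont.
have [u xu] := dense_embedding_approx hj x (e := e / 2) (divr_gt0 e0 (ltr0n _ 2)).
have [|w [f hf] uw] := rdomain_dense hj ac ell u (e := e / 2 / K).
  by rewrite !divr_gt0.
exists (j w), (- f); split.
  by rewrite genS /opp_operator /= opprK; apply/associated_operatorP; exists w.
have -> : x - j w = x - j u + j (u - w) by rewrite (linearB j) addrA subrK.
have := rnorm_triangle (x - j u) (j (u - w)).
have := jK (u - w); move: uw; rewrite ltr_pdivlMr//; lra.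
Qed.

Lemma isometry_continuous H1 H2 (Phi : {linear H1 -> H2}) :
  (forall x y, inner (Phi x) (Phi y) = inner x y) -> continuous Phi.
Proof.
move=> iso x; apply/cvg_rnormP => e e0.
have /cvg_rnormP/(_ e e0) : y @[y --> x] --> x by [].
by apply: filterS => y; rewrite -linearB isometry_rnorm.
Qed.

Lemma isometry_inverse H1 H2 (Phi : {linear H1 -> H2}) :
  bijective Phi -> (forall x y, inner (Phi x) (Phi y) = inner x y) ->
  exists Psi : {linear H2 -> H1}, [/\ cancel Phi Psi, cancel Psi Phi &
    forall x y, inner (Psi x) (Psi y) = inner x y].
Proof.
move=> [g Phig gPhi] iso.
pose Psi : {linear H2 -> H1} :=
  HB.pack g (GRing.isLinear.Build _ _ _ _ g (can2_linear Phig gPhi)).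
by exists Psi; split=> // x y; rewrite -iso !gPhi.
Qed.

End FormSemigroups.

(** * Equivalence of intertwining and invariance of the forms *)

Theorem corollary2p4 (R : realType) (H1 H2 V1 V2 : hilbertType R)
    (j1 : {linear V1 -> H1}) (j2 : {linear V2 -> H2})
    (hj1 : dense_embedding j1) (hj2 : dense_embedding j2)
    (a1 : sesquilinear_form V1) (a2 : sesquilinear_form V2)
    (ca1 : continuous_form a1) (ca2 : continuous_form a2)
    (ea1 : elliptic j1 a1) (ea2 : elliptic j2 a2)
    (S1 : R -> {linear H1 -> H1}) (S2 : R -> {linear H2 -> H2})
    (hS1 : semigroup_generated_by S1 (opp_operator (associated_operator j1 a1)))
    (hS2 : semigroup_generated_by S2 (opp_operator (associated_operator j2 a2)))
    (Phi : {linear H1 -> H2}) (hPhi : unitary Phi) :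
  (forall t : R, 0 < t -> S2 t \o Phi = Phi \o S1 t)
  <->
  (Phi @` range j1 = range j2 /\
   forall (u v : V1) (Phiu Phiv : V2),
     j2 Phiu = Phi (j1 u) -> j2 Phiv = Phi (j1 v) ->
     a2 Phiu Phiv = a1 u v).
Proof.
have [Phi_cont Phi_bij iso] := hPhi.
have [CS1 gen1] := hS1; have [CS2 gen2] := hS2.
split=> [comm|[im_eq form_eq]].
  have [Psi [PhiK PsiK Psi_iso]] := isometry_inverse Phi_bij iso.
  have graph x f : associated_operator j1 a1 (x, f) ->
      associated_operator j2 a2 (Phi x, Phi f).
    move=> xf; have : generator S1 (x, - f).
      by rewrite gen1 /opp_operator /= opprK.
    have comm' t y : 0 < t -> S2 t (Phi y) = Phi (S1 t y).
      by move=> /comm/(congr1 (@^~ y)).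
    move=> /(generator_continuous_image Phi_cont comm').
    by rewrite gen2 /opp_operator /= -(linearN Phi) opprK.
  have graph' x f : associated_operator j2 a2 (x, f) ->
      associated_operator j1 a1 (Psi x, Psi f).
    move=> xf; have : generator S2 (x, - f).
      by rewrite gen2 /opp_operator /= opprK.
    have comm' t y : 0 < t -> S1 t (Psi y) = Psi (S2 t y).
      move=> /comm/(congr1 (@^~ (Psi y))) /=.
      by rewrite PsiK => ->; rewrite PhiK.
    move=> /(generator_continuous_image (isometry_continuous Psi_iso) comm').
    by rewrite gen1 /opp_operator /= -(linearN Psi) opprK.
  (* Transfer along [Phi] gives one inclusion and the form identity; transfer along its inverse
     gives the other inclusion. *)
  have [im forms] := form_transfer hj1 hj2 ca1 ca2 ea1 ea2 iso graph.
  have [im' _] := form_transfer hj2 hj1 ca2 ca1 ea2 ea1 Psi_iso graph'.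
  split=> //; apply/seteqP; split=> [_ [_ [u _ <-] <-]|_ [u' _ <-]].
    by have [u' <-] := im u; exists u'.
  have [u uE] := im' u'; exists (j1 u); first by exists u.
  by rewrite uE PsiK.
(* Equality of the ranges lifts Phi (j1 u) to V2 and provides a preimage in V1 for every test vector
   v', so the identity defining [A1] turns into that for [A2]. *)
have gen x y : generator S1 (x, y) -> generator S2 (Phi x, Phi y).
  rewrite gen1 gen2 => -[u /= ux uy].
  have [u' _ u'E] : range j2 (Phi (j1 u)).
    by rewrite -im_eq; exists (j1 u) => //; exists u.
  exists u' => /=; first by rewrite u'E ux.
  move=> v'; have [_ [v _ <-] v'E] : (Phi @` range j1) (j2 v').
    by rewrite im_eq; exists v'.
  by rewrite (form_eq u v) // -v'E uy -(linearN Phi) iso.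
have [omega omega0 diss] := generated_dissipative ea2 hS2.
have dense_dom := generated_domain_dense hj1 ca1 ea1 hS1.
move=> t t0; apply/funext => x /=.
exact: semigroup_intertwine CS1 CS2 Phi_cont gen omega0 diss dense_dom t x t0.
Qed.
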